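(* For all integers $k\geq 5$ and $\ell\geq 3$, there exists an oriented graph $D$ with oriented chromatic number $\chi_o(D)=k$ and girth $\ell$.
   Context: An oriented graph $D$ is a digraph with vertex set $V(D)$ and arc set $A(D)$ such that for every pair of vertices $u,v$ at most one of $uv$ and $vu$ is in $A(D)$; oriented graphs are always finite and loopless, without multiple arcs. The girth of an oriented graph is the length of a shortest directed cycle in it. For oriented graphs $D$ and $C$, a homomorphism from $D$ to $C$ is a map $f\colon V(D)\to V(C)$ such that $xy\in A(D)$ implies $f(x)f(y)\in A(C)$. A tournament on $n$ vertices is an oriented graph obtained by assigning a direction to each edge of the complete graph $K_n$. The oriented chromatic number $\chi_o(D)$ is the minimum number of vertices of an oriented graph $C$ such that there exists a homomorphism from $D$ to $C$; equivalently, the minimum number of vertices of a tournament $T$ such that there exists a homomorphism from $D$ to $T$. *)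

(* Defs.v *)
From mathcomp Require Import all_boot.

Set Implicit Arguments.
Unset Strict Implicit.
Unset Printing Implicit Defensive.

(* The case u = v of [arc_asym] forbids loops. *)
Record ograph := OGraph {
  vertex :> finType;
  arc : rel vertex;
  arc_asym : forall u v : vertex, ~~ (arc u v && arc v u)
}.

Definition is_hom (D C : ograph) (f : D -> C) : Prop :=
  forall x y : D, arc x y -> arc (f x) (f y).

Definition has_hom (D C : ograph) : Prop := exists f : D -> C, is_hom f.

(* k is the minimum of the numbers of vertices of the targets of D; this
   minimum exists, since D maps to itself. *)
Definition oriented_chromatic_number (D : ograph) (k : nat) : Prop :=
  (exists2 C : ograph, has_hom D C & #|C| = k) /\
  (forall C : ograph, has_hom D C -> k <= #|C|).

(* [ucycle e [::]] holds, so the empty sequence has to be excluded. *)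
Definition dicycle (D : ograph) (c : seq D) : Prop :=
  c <> [::] /\ ucycle (@arc D) c.

(* No l satisfies this when D is acyclic. *)
Definition girth (D : ograph) (l : nat) : Prop :=
  (exists2 c : seq D, dicycle c & size c = l) /\
  (forall c : seq D, dicycle c -> l <= size c).

(* Main.v *)
Require Import Defs.
From mathcomp Require Import all_boot.
From mathcomp Require Import zify.
(* [arc] also names a function on sequences; this makes it the arc relation. *)
Import Defs.

Set Implicit Arguments.
Unset Strict Implicit.
Unset Printing Implicit Defensive.

(** Directed girth sees only directed cycles, so the chromatic number and the
girth can be prescribed on two disjoint pieces, one acyclic and one a directed
cycle; the only interaction is that both must map to one target on k vertices.

The acyclic piece is the transitive tournament on 0 < 1 < ... < k-1 without the
arc from 0 to k-1. Any two of its vertices are adjacent or joined by a directed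
path of length 2, and such vertices never have the same image
([oclique_hom_inj]); hence every target has at least k vertices. The tournament
itself would force a transitive target, to which no directed cycle maps; with
one arc missing, that arc can be reversed, giving a strong tournament on the
same k vertices. For k >= 5 this tournament has cycles of length 3, 4 and 5
through the vertex 0, hence closed walks of every length l >= 3
([closed_walk]), and the directed l-cycle maps to it. *)

(** * Disjoint unions and cliques *)

Definition osum_rel (D C : ograph) : rel (D + C) := fun u v =>
  match u, v with
  | inl x, inl y => arc x y
  | inr x, inr y => arc x y
  | _, _ => false
  end.

Lemma osum_asym (D C : ograph) (u v : D + C) :
  ~~ (osum_rel u v && osum_rel v u).
Proof. by case: u v => [x|x] [y|y] //=; apply: arc_asym. Qed.

Definition osum (D C : ograph) : ograph := OGraph (@osum_asym D C).

Lemma has_hom_osum (D C T : ograph) :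
  has_hom D T -> has_hom C T -> has_hom (osum D C) T.
Proof.
move=> [f hf] [g hg]; exists (fun u => match u with inl x => f x | inr x => g x end).
by move=> [x|x] [y|y] //=; [apply: hf | apply: hg].
Qed.

Lemma has_hom_osuml (D C T : ograph) : has_hom (osum D C) T -> has_hom D T.
Proof. by move=> [f hf]; exists (f \o inl) => x y xy; apply: hf. Qed.

Definition oclique (D : ograph) : Prop :=
  forall x y : D, x != y ->
    [\/ arc x y, arc y x, exists2 z, arc x z & arc z y
      | exists2 z, arc y z & arc z x].

(** If the ends of an arc had a common image it would carry a loop, and if the
ends of a directed 2-path had one, the image would contain opposite arcs. *)
Lemma oclique_hom_inj (D C : ograph) (f : D -> C) :
  oclique D -> is_hom f -> injective f.
Proof.
move=> cl hf x y fxy; apply/eqP/negPn/negP => /cl.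
have opp (u v : C) : arc u v -> arc v u -> False.
  by move=> uv vu; have := arc_asym u v; rewrite uv vu.
case=> [/hf|/hf|[z /hf xz /hf zy]|[z /hf yz /hf zx]].
- by rewrite fxy => a; apply: (opp _ _ a a).
- by rewrite fxy => a; apply: (opp _ _ a a).
- by rewrite -fxy in zy; apply: (opp _ _ xz zy).
- by rewrite fxy in zx; apply: (opp _ _ yz zx).
Qed.

Lemma oclique_leq_card (D C : ograph) : oclique D -> has_hom D C -> #|D| <= #|C|.
Proof. by move=> cl [f /(oclique_hom_inj cl)]; apply: leq_card. Qed.

Lemma dicycle_next (D : ograph) (c : seq D) (x : D) :
  dicycle c -> x \in c -> exists2 y, y \in c & arc x y.
Proof.
move=> [_ /andP[cyc _]] xc; exists (next c x); first by rewrite mem_next.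
exact: next_cycle cyc xc.
Qed.

(** * The transitive tournament with its longest arc removed or reversed *)

Section Tournaments.
Variable k : nat.

Definition cut_rel : rel 'I_k :=
  fun i j => (i < j) && ~~ ((i == 0 :> nat) && (j == k.-1 :> nat)).

Definition flip_rel : rel 'I_k :=
  fun i j => cut_rel i j || [&& j < i, j == 0 :> nat & i == k.-1 :> nat].

Lemma cut_asym i j : ~~ (cut_rel i j && cut_rel j i).
Proof. by rewrite /cut_rel; lia. Qed.

Lemma flip_asym i j : ~~ (flip_rel i j && flip_rel j i).
Proof. by rewrite /flip_rel /cut_rel; lia. Qed.

Definition cut_tournament : ograph := OGraph cut_asym.
Definition flip_tournament : ograph := OGraph flip_asym.

Lemma cut_has_hom_flip : has_hom cut_tournament flip_tournament.
Proof. by exists id => i j /= ij; rewrite /flip_rel ij. Qed.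

(** The only nonadjacent pair 0, k-1 is joined by the path through 1. *)
Lemma cut_oclique : 2 < k -> oclique cut_tournament.
Proof.
move=> k2 i j; rewrite -(inj_eq val_inj) /= => nij.
have k1 : 1 < k by lia.
have mid (x y : 'I_k) : x < y -> ~~ cut_rel x y ->
    exists2 z : 'I_k, cut_rel x z & cut_rel z y.
  move=> xy nxy; exists (Ordinal k1); move: nxy; rewrite /cut_rel /=; lia.
case: (boolP (cut_rel i j)) => [ij|nc]; first by constructor 1.
case: (boolP (cut_rel j i)) => [ji|nc']; first by constructor 2.
by case: (ltngtP i j) nij => // [ij|ji] _;
  [constructor 3; apply: mid | constructor 4; apply: mid].
Qed.

(** The walk runs 0, 1, ..., r+1, k-1 with r the residue of l modulo 3, and
then goes round the triangle 0, 1, k-1; the value of r makes it end at k-1,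
from which the reversed arc leads back to 0. *)
Definition closed_walk (l i : nat) : nat :=
  if i < (l %% 3).+2 then i else
  match (i - (l %% 3).+2) %% 3 with 0 => k.-1 | 1 => 0 | _ => 1 end.

Lemma closed_walk_lt l i : 4 < k -> closed_walk l i < k.
Proof.
move=> k4; rewrite /closed_walk; case: ifP => [|_]; first by lia.
by case: (_ %% 3) => [|[|?]]; lia.
Qed.
End Tournaments.

(** * The directed cycle *)

Section DirectedCycle.
Variable l : nat.
Hypothesis l_gt2 : 2 < l.

Lemma ordS_asym (i j : 'I_l) : ~~ ((j == ordS i) && (i == ordS j)).
Proof.
apply/negP => /andP[/eqP -> /eqP /(congr1 val) /=].
have := ltn_ord i; have [il|ne] := eqVneq i.+1 l.
  by rewrite il modnn modn_small; lia.
move=> lt_il; rewrite (@modn_small i.+1); last by lia.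
by have [e|ne'] := eqVneq i.+2 l; [rewrite e modnn | rewrite modn_small]; lia.
Qed.

Definition directed_cycle : ograph := OGraph ordS_asym.

Lemma directed_cycle_has_hom_flip k :
  4 < k -> has_hom directed_cycle (flip_tournament k).
Proof.
move=> k4; exists (fun i : 'I_l => Ordinal (closed_walk_lt l i k4)).
move=> i j /= /eqP ->; have il := ltn_ord i.
rewrite /flip_rel /cut_rel /=.
have [i_last|ne] := eqVneq i.+1 l.
  rewrite i_last modnn.
  have -> : closed_walk k l i = k.-1.
    rewrite /closed_walk; case: ifP => [|_]; first by lia.
    by have -> : (i - (l %% 3).+2) %% 3 = 0 by lia.
  by rewrite /closed_walk /=; lia.
rewrite modn_small; last by lia.
rewrite /closed_walk; have r3 := ltn_pmod l (isT : 0 < 3).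
case: (ltnP i.+1 (l %% 3).+2) => [lt|le].
  by rewrite ifT; lia.
case: (ltnP i (l %% 3).+2) => [lt|le'].
  by rewrite (_ : (i.+1 - (l %% 3).+2) %% 3 = 0); lia.
have m3 := ltn_pmod (i - (l %% 3).+2) (isT : 0 < 3).
have : (i.+1 - (l %% 3).+2) %% 3 = ((i - (l %% 3).+2) %% 3).+1 %% 3 by lia.
move=> ->; case: (_ %% 3) m3 => [|[|[|?]]] //= _; lia.
Qed.

Section Girth.
Variable k : nat.
Let D := osum (cut_tournament k) directed_cycle.

(** Arcs of the acyclic piece increase the label, so following a cycle through
it would produce labels of every size. *)
Lemma dicycle_notin_cut (c : seq D) (i : 'I_k) : dicycle c -> inl i \notin c.
Proof.
move=> cyc; apply/negP => ic.
have climb n : exists2 j : 'I_k, (inl j : D) \in c & n <= j.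
  elim: n => [|n [j jc nj]]; first by exists i.
  have [[j'|//] j'c /= /andP[jj' _]] := dicycle_next cyc jc.
  by exists j' => //; apply: leq_ltn_trans jj'.
by have [j _] := climb k; rewrite leqNgt ltn_ord.
Qed.

(** A cycle meets the directed cycle, and is closed under successors there, so
it contains all the l vertices. *)
Lemma dicycle_leq_size (c : seq D) : dicycle c -> l <= size c.
Proof.
move=> cyc; have [i ic] : exists i : 'I_l, (inr i : D) \in c.
  case: (cyc) => cN _; case: c cN cyc => // -[i|i] c _ cyc.
    by have := dicycle_notin_cut i cyc; rewrite mem_head.
  by exists i; rewrite mem_head.
have iterS n : exists2 j : 'I_l, (inr j : D) \in c & (j = (i + n) %% l :> nat).
  elim: n => [|n [j jc jE]]; first by exists i; rewrite // addn0 modn_small.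
  have [[//|j'] j'c /= /eqP j'E] := dicycle_next cyc jc.
  by exists j' => //; rewrite j'E /= jE addnS -addn1 modnDml addn1.
have all_c (j : 'I_l) : (inr j : D) \in c.
  have [j' j'c j'E] := iterS (l - i + j).
  suff -> : j = j' by [].
  apply: val_inj; rewrite /= j'E addnA subnKC ?modnDl ?modn_small //.
  exact: ltnW.
rewrite -[X in X <= _](card_ord l) cardE -(size_map (inr : 'I_l -> D)).
apply: uniq_leq_size => [|_ /mapP[j _ ->] //].
by rewrite map_inj_uniq ?enum_uniq // => ? ? [].
Qed.

Lemma girth_osum_cycle : girth D l.
Proof.
split; last exact: dicycle_leq_size.
pose x0 : 'I_l := Ordinal (ltnW (ltnW l_gt2)).
pose c : seq D := map inr (orbit (@ordS l) x0).
have cyc : dicycle c.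
  split; first by move/(congr1 size); rewrite size_map size_orbit => o0;
    have := order_gt0 (@ordS l) x0; rewrite o0.
  apply/andP; split; last by rewrite map_inj_uniq ?orbit_uniq // => ? ? [].
  rewrite cycle_map; apply: sub_cycle (cycle_orbit (@ordS_inj l) x0).
  by move=> i j /= /eqP ->.
(* An orbit has at most l elements, and as a cycle it has at least l. *)
exists c => //; apply/eqP; rewrite eqn_leq dicycle_leq_size // andbT.
by rewrite size_map -[X in _ <= X](card_ord l) -(card_uniqP (orbit_uniq _ _)) max_card.
Qed.
End Girth.
End DirectedCycle.

Theorem theorem5p1 (k l : nat) (hk : 5 <= k) (hl : 3 <= l) :
  exists D : ograph, oriented_chromatic_number D k /\ girth D l.
Proof.
exists (osum (cut_tournament k) (directed_cycle hl)).
split; last exact: girth_osum_cycle.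
split.
  exists (flip_tournament k); last exact: card_ord.
  exact: has_hom_osum (cut_has_hom_flip k) (directed_cycle_has_hom_flip hl hk).
move=> C /has_hom_osuml /oclique_leq_card; rewrite card_ord; apply.
by apply: cut_oclique; lia.
Qed.
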